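(* Let $u\in\mathcal{D}$, $v\in dom\,\mathcal{E}$, and let $V_M$ be the corresponding boundary for $u$ (i.e. $M\ge 0$ is such that $u\in\mathcal{D}_M$). Then $$\mathcal{E}(u,v)=\sum_{p\in V_M}v(p)\,(du)(p)-\int_{\Sigma_N^+}(\Delta u)\,v\,\mathrm{d}\mu.$$ Moreover, $$\sum_{p\in V_M}(du)(p)=\int_{\Sigma_N^+}\Delta u\,\mathrm{d}\mu.$$
   Context: Fix an integer $N\ge 2$, $S=\{1,\dots,N\}$, and let $\Sigma_N^+=\{x=(x_1x_2\cdots):x_i\in S\}$ with the product topology. Cylinder sets: $[p_1\cdots p_m]=\{x: x_1=p_1,\dots,x_m=p_m\}$. $\mu$ is the Borel probability measure with $\mu([p_1\cdots p_m])=N^{-m}$. $\mathcal{C}(\Sigma_N^+)$ is the set of real continuous functions. For $m\ge 0$, $V_m$ is the set of sequences $p=(p_1\cdots p_m\,p_{m+1}\,p_{m+1}\cdots)$ that are constant from position $m+1$ on; $V_0\subset V_1\subset\cdots$, and $V_{-1}=\emptyset$. For $p\in V_m$, $\mathcal{U}_{p,m}=\{q\in V_m: q\ne p,\ q_i=p_i \text{ for } 1\le i\le m\}$ (a set of $N-1$ points; for $m=0$ it is $V_0\setminus\{p\}$). For $p\in\bigcup_m V_m$, $\kappa_p=\min\{j:p\in V_j\}$. For a real function $u$ defined (at least) on $V_m$ and $p\in V_m$, the difference operator is $$H_m u(p)=\sum_{j=\kappa_p}^{m}\ \sum_{q\in\mathcal{U}_{p,j}}(u(q)-u(p)).$$ Laplacian: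 for $u,f\in\mathcal{C}(\Sigma_N^+)$, $\Delta u=f$ means $\lim_{m\to\infty}\max_{p\in V_m\setminus V_{m-1}}\left|\frac{H_mu(p)}{\mu([p_1\cdots p_{m+1}])}-f(p)\right|=0$. $D_\mu$ is the set of $u\in\mathcal{C}(\Sigma_N^+)$ for which such an $f$ exists. For $M\ge0$, $\mathcal{D}_M$ is the set of $u\in D_\mu$ for which there is $f\in\mathcal{C}(\Sigma_N^+)$ with $\Delta u=f$ and $\lim_{m\to\infty}\max_{p\in V_m\setminus V_M}\left|\frac{H_mu(p)}{\mu([p_1\cdots p_{m+1}])}-f(p)\right|=0$. $\mathcal{D}=\bigcup_{M\ge0}\mathcal{D}_M$. When $u\in\mathcal{D}_M$, the set $V_M$ is taken as the boundary of $\Sigma_N^+$ corresponding to $u$. Energy: $\mathcal{E}_{H_m}(u,v)=-\sum_{p\in V_m}u(p)H_mv(p)=\frac12\sum_{i=0}^m\sum_{p\in V_i}\sum_{q\in\mathcal{U}_{p,i}}(u(p)-u(q))(v(p)-v(q))$; $\mathcal{E}(u,v)=\lim_{m\to\infty}\mathcal{E}_{H_m}(u,v)$, $\mathcal{E}(u)=\mathcal{E}(u,u)$; $dom\,\mathcal{E}$ is the set of $u\in\mathcal{C}(\Sigma_N^+)$ with $\mathcal{E}(u)<\infty$ (one has $D_\mu\subset dom\,\mathcal{E}$). Neumann derivative: for $u\in\mathcal{D}$ with corresponding boundary $V_M$ and $p\in V_M$, $(du)(p):=\lim_{m\to\infty}-H_mu(p)$ (this limit exists). *)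

(* Defs.v *)
From HB Require Import structures.
From mathcomp Require Import all_boot all_order all_algebra.
From mathcomp Require Import all_classical all_reals all_analysis.

Set Implicit Arguments.
Unset Strict Implicit.
Unset Printing Implicit Defensive.

Import Order.TTheory GRing.Theory Num.Theory.
Import numFieldNormedType.Exports.

Local Open Scope classical_set_scope.
Local Open Scope ring_scope.

(* For N >= 1 this is 'I_N; the successor form gives it a point for every N,
   as mathcomp-analysis requires of measurable spaces. *)
Definition symbol (N : nat) : Type := 'I_N.-1.+1.
HB.instance Definition _ (N : nat) := Choice.on (symbol N).
HB.instance Definition _ (N : nat) :=
  isPointed.Build (symbol N) (ord0 : 'I_N.-1.+1).

(* Sequences are 0-based: [x i] is the letter written x_{i+1} on paper. *)
Definition shift_space (N : nat) : Type :=
  prod_topology (fun _ : nat => discrete_topology (symbol N)).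
HB.instance Definition _ (N : nat) := Pointed.on (shift_space N).
HB.instance Definition _ (N : nat) := Nbhs.on (shift_space N).
HB.instance Definition _ (N : nat) := Topological.on (shift_space N).

Definition borel_shift (N : nat) :=
  g_sigma_algebraType (@open (shift_space N)).

Section definitions.
Context {R : realType} {N : nat}.
Implicit Types (p q x : shift_space N) (u v f : shift_space N -> R).
Implicit Type mu : probability (borel_shift N) R.

(* [p_1 ... p_m]; every finite word is the prefix of some p. *)
Definition cylinder p (m : nat) : set (shift_space N) :=
  [set x | forall i, (i < m)%N -> x i = p i].

Definition V (m : nat) : set (shift_space N) :=
  [set p | forall i, (m <= i)%N -> p i = p m].

(* V_{m-1}, with V_{-1} empty. *)
Definition Vprev (m : nat) : set (shift_space N) :=
  if m is k.+1 then V k else set0.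

Definition U p (m : nat) : set (shift_space N) :=
  [set q | [/\ V m q, q <> p & forall i, (i < m)%N -> q i = p i]].

(* min {j | p \in V_j}; only meaningful when p lies in some V_j. *)
Definition kappa p : nat :=
  xget 0%N [set j | V j p /\ forall k, V k p -> (j <= k)%N].

(* The sets V m and U p j are finite, so the [\in] sums below are genuine. *)
Definition H (m : nat) u p : R :=
  \sum_(kappa p <= j < m.+1) \sum_(q \in U p j) (u q - u p).

(* Maximum over p \in A of |H_m u(p) / mu[p_1 ... p_{m+1}] - f(p)|, for a
   finite set A (0 if A is empty). *)
Definition max_defect mu u f (m : nat) (A : set (shift_space N)) : R :=
  \big[Num.max/0]_(p \in A)
    `|H m u p / fine (mu (cylinder p m.+1)) - f p|.

(* Delta u = f *)
Definition is_laplacian mu u f : Prop :=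
  [/\ continuous u, continuous f &
      max_defect mu u f m (V m `\` Vprev m) @[m --> \oo] --> 0].

(* u \in D_M *)
Definition domD mu (M : nat) u : Prop :=
  exists2 f, is_laplacian mu u f &
    max_defect mu u f m (V m `\` V M) @[m --> \oo] --> 0.

Definition energyH (m : nat) u v : R :=
  - \sum_(p \in V m) u p * H m v p.

(* The limit is taken in \bar R, so that energy u u = +oo is possible. *)
Definition energy u v : \bar R :=
  lim ((energyH m u v)%:E @[m --> \oo]).

Definition dom_energy u : Prop := continuous u /\ (energy u u < +oo)%E.

(* (du)(p) *)
Definition neumann u p : R := lim (- H m u p @[m --> \oo]).

End definitions.

(* Main.v *)
Require Import Defs.
From mathcomp Require Import all_boot all_order all_algebra.
From mathcomp Require Import finmap measurable_realfun.
From mathcomp Require Import all_classical all_reals all_analysis.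

(** Each [H_m] is the Laplacian of a finite graph on [V m] whose edges join
    [p], [q] in [V j] (for [j <= m]) that share their first [j] letters.  The
    edge relation is symmetric, so [energyH m] is a symmetric form and
    [energyH m u v] is also [- \sum_(p in V m) v p * H m u p]
    ([energyH_adj]).  The sum splits over [V M] and [V m] minus [V M].

    Off the boundary, [H m u p] is [f p / N ^ (m+1)] up to an error that is
    uniformly small relative to [1 / N ^ (m+1)], where [f] is the Laplacian of
    [u]; the points of [V m] are in bijection with the cylinders of length
    [m+1], so this part of the sum is a Riemann sum and tends to the integral
    of [f * v] ([sum_off_boundary_cvg]).

    On the boundary one needs the limit of [- H m u p] to exist.  Take for
    [v] the indicator [w] of the cylinder of length [M+1] around [p].  Since
    [w] only depends on [M+1] letters, [energyH m u w] does not depend on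
    [m >= M]; since [p] is the only point of [V M] in that cylinder, the
    splitting above reads [energyH M u w = - H m u p - S m] with [S m]
    convergent by the previous paragraph ([neumann_cvg]).

    Together these give the limit of [energyH m u v] for every continuous [v]
    ([energy_cvg]).  The second identity is the case [v = 1], whose energy
    vanishes.  Finally, points of [V m] off [V (m-1)], with [m] large,
    lie arbitrarily near every point of the space, so a continuous Laplacian
    is unique ([laplacian_unique]), and the function witnessing membership in
    the domain is the given one. *)

Import Order.TTheory GRing.Theory Num.Theory.
Import numFieldNormedType.Exports.

Set Implicit Arguments.
Unset Strict Implicit.
Unset Printing Implicit Defensive.

Local Open Scope classical_set_scope.
Local Open Scope ring_scope.

(** * Truncation and the finite vertex sets *)

Section truncation.
Context {N : nat}.
Implicit Types (p q x : shift_space N).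

(** The sequence that keeps the letters of [x] of index [0, ..., m] and then
    repeats the last of them; a retraction of the space onto [V m]. *)
Definition trunc (m : nat) x : shift_space N := fun i => x (minn i m).

Lemma V_trunc m x : V m (trunc m x).
Proof. by move=> i mi; rewrite /trunc minnn (minn_idPr mi). Qed.

Lemma trunc_id m p : V m p -> trunc m p = p.
Proof.
move=> Vp; apply/funext => i; rewrite /trunc.
by case: (leqP i m) => im //; rewrite Vp // ltnW.
Qed.

Lemma cylinder_trunc m p : V m p ->
  forall x, cylinder p m.+1 x <-> trunc m x = p.
Proof.
move=> Vp x; split => [cx|<- i im].
  by rewrite -(trunc_id Vp); apply/funext => i; rewrite /trunc cx // ltnS geq_minr.
by rewrite /trunc (minn_idPl _).
Qed.

Lemma V_sub j m : (j <= m)%N -> V j `<=` @V N m.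
Proof. by move=> jm p Vp i mi; rewrite Vp ?(leq_trans jm) // (Vp m). Qed.

Lemma finite_V m : finite_set (@V N m).
Proof.
(* A point of [V m] is determined by its first [m+1] letters. *)
pose ext (w : {ffun 'I_m.+1 -> 'I_N.-1.+1}) : shift_space N :=
  fun i => w (inord (minn i m)).
apply: (@sub_finite_set _ _ (ext @` setT)); last exact: finite_image.
move=> p Vp; exists [ffun i : 'I_m.+1 => p i] => //.
rewrite -[RHS](trunc_id Vp); apply/funext => i.
by rewrite /ext ffunE inordK // ltnS geq_minr.
Qed.

(** The points of [V m], listed without repetition. *)
Definition verts (m : nat) : seq (shift_space N) := fset_set (V m).

Lemma mem_verts m p : (p \in verts m) = (p \in V m).
Proof. by rewrite /verts in_fset_set //; exact: finite_V. Qed.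

Lemma sum_V (R : realType) m (F : shift_space N -> R) :
  \sum_(p \in V m) F p = \sum_(p <- verts m) F p.
Proof. by rewrite fsbig_finite //; exact: finite_V. Qed.

Lemma sum_verts_sub (R : realType) (A : set (shift_space N)) j m
    (F : shift_space N -> R) : (j <= m)%N -> A `<=` V j ->
  \sum_(p \in A) F p = \sum_(p <- verts m | p \in A) F p.
Proof.
move=> jm AV; have AVm : A `<=` V m := subset_trans AV (V_sub jm).
have fA : finite_set A := sub_finite_set AVm (finite_V m).
rewrite fsbig_finite // -[RHS]big_filter; apply: perm_big.
apply: uniq_perm; rewrite ?fset_uniq ?filter_uniq ?fset_uniq // => p.
rewrite in_fset_set // mem_filter mem_verts.
case: (boolP (p \in A)) => //= pA.
by apply/esym/mem_set/AVm; exact/set_mem.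
Qed.

(** This turns the range [kappa p <= j] of the sum defining [H m u p] into the
    condition that [p] is a vertex of level [j]. *)
Lemma kappa_le p j m : V m p -> (kappa p <= j)%N = (p \in V j).
Proof.
move=> Vmp.
have [k Vk kmin] : exists2 k, V k p & forall l, V l p -> (k <= l)%N.
  have ex : exists k, `[< V k p >] by exists m; apply/asboolP.
  exists (ex_minn ex); case: ex_minnP => k /asboolP // Vk kmin l Vl.
  by apply: kmin; exact/asboolP.
have [Vkp kpmin] : [set j | V j p /\ forall k, V k p -> (j <= k)%N] (kappa p).
  by apply: (@xgetPex _ 0%N); exists k.
apply/idP/idP => [kj|/set_mem/kpmin //].
by apply/mem_set; exact: V_sub Vkp.
Qed.

End truncation.

(** * The difference operators as symmetric graph Laplacians *)

Section graph.
Context {R : realType} {N : nat}.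
Implicit Types (p q x : shift_space N) (u v f : shift_space N -> R).

(** Adjacency at level [j]: [p] and [q] are distinct points of [V j] with the
    same first [j] letters. *)
Definition edge (j : nat) p q : bool := (p \in V j) && (q \in U p j).

Lemma edge_sym j p q : edge j p q = edge j q p.
Proof.
suff im a b : edge j a b -> edge j b a by apply/idP/idP; exact: im.
case/andP => /set_mem Va /set_mem [Vb ba ab].
apply/andP; split; apply/mem_set => //; split => // [/esym //|i ij].
by rewrite ab.
Qed.

Lemma H_edge m u p : V m p -> H m u p =
  \sum_(j < m.+1) \sum_(q <- verts m | edge j p q) (u q - u p).
Proof.
move=> Vp; have km : (kappa p <= m)%N by rewrite (kappa_le _ Vp); exact/mem_set.
rewrite /H -(big_mkord xpredT
  (fun j => \sum_(q <- verts m | edge j p q) (u q - u p))).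
rewrite (@big_cat_nat _ _ _ (kappa p) 0%N m.+1) //= ?leqW // [X in _ = X + _]big1_seq; last first.
  move=> j /andP[_]; rewrite mem_index_iota => /andP[_ jk].
  rewrite big1 // => q; rewrite /edge -(kappa_le _ Vp) leqNgt jk //.
rewrite add0r; apply: eq_big_nat => j /andP[kj jm].
rewrite (@sum_verts_sub _ _ _ j m) //; last by move=> q [].
by apply: eq_bigl => q; rewrite /edge -(kappa_le _ Vp) kj.
Qed.

Lemma energyH_edge m u v : energyH m u v =
  - \sum_(j < m.+1) \sum_(p <- verts m) \sum_(q <- verts m | edge j p q)
      (u p * v q - u p * v p).
Proof.
rewrite /energyH sum_V exchange_big /=; congr (- _).
apply: eq_big_seq => p; rewrite mem_verts => /set_mem Vp.
rewrite H_edge // mulr_sumr; apply: eq_bigr => j _.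
by rewrite mulr_sumr; apply: eq_bigr => q _; rewrite mulrBr.
Qed.

(** Summation by parts on the finite graph. *)
Lemma energyHC m u v : energyH m u v = energyH m v u.
Proof.
rewrite !energyH_edge; congr (- _); apply: eq_bigr => j _.
under eq_bigr do rewrite sumrB.
under [RHS]eq_bigr do rewrite sumrB.
rewrite !sumrB; congr (_ - _).
  rewrite (exchange_big_dep xpredT) //=; apply: eq_bigr => p _.
  by apply: eq_big => q; [rewrite edge_sym|rewrite mulrC].
apply: eq_bigr => p _; apply: eq_bigr => q _; exact: mulrC.
Qed.

Lemma energyH_adj m u v : energyH m u v = - \sum_(p <- verts m) v p * H m u p.
Proof. by rewrite energyHC /energyH sum_V. Qed.

(** If [u] depends only on the first [M+1] letters, then [u] is constant along
    the edges of level above [M]. *)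
Lemma H_locally_const M m u p :
    (forall x y : shift_space N, (forall i, (i <= M)%N -> x i = y i) -> u x = u y) ->
    (M <= m)%N -> V m p ->
  H m u p = if p \in V M then H M u p else 0.
Proof.
move=> uM Mm Vp.
have U0 j : (M < j)%N -> \sum_(q \in U p j) (u q - u p) = 0.
  move=> Mj; rewrite fsbig1 // => q [_ _ qp]; apply/eqP; rewrite subr_eq0.
  by apply/eqP/uM => i iM; apply: qp; exact: leq_ltn_trans Mj.
rewrite /H -(kappa_le _ Vp); case: leqP => kM.
  rewrite (@big_cat_nat _ _ _ M.+1) //= ?ltnS ?leqW //.
  rewrite [X in _ + X]big1_seq ?addr0 // => j /andP[_].
  by rewrite mem_index_iota => /andP[/U0].
rewrite big1_seq // => j /andP[_].
by rewrite mem_index_iota => /andP[kj _]; apply: U0; exact: leq_trans kj.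
Qed.

End graph.

(** * Topology of the shift space and Riemann sums *)

Section topology.
Context {R : realType} {N : nat}.
Implicit Types (p q x : shift_space N) (u v f g : shift_space N -> R).

(** Convergence in the product of discrete spaces is eventual agreement of
    each letter. *)
Lemma cvg_agree (y : nat -> shift_space N) x :
  (forall m i, (i < m)%N -> y m i = x i) -> y @ \oo --> x.
Proof.
move=> yx; apply/cvg_sup => i U [W [[Z] oZ <-] Zx] WU.
apply: filterS WU _; exists i.+1 => // m /= im.
by rewrite /= yx.
Qed.

Lemma open_cylinder p m : open (cylinder p m).
Proof.
elim: m => [|m IH].
  by rewrite (_ : cylinder p 0 = setT); [exact: openT|rewrite predeqE].
rewrite (_ : cylinder p m.+1 = cylinder p m `&`
    (@proj nat (fun=> discrete_topology (symbol N)) m) @^-1` [set p m]).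
  apply: openI => //; apply: open_comp; last exact: discrete_open.
  by move=> x _; exact: proj_continuous.
rewrite predeqE => x; split=> [c|[c cm] i].
  by split=> [i im|]; apply: c => //; exact: ltnW.
by rewrite ltnS leq_eqVlt => /orP[/eqP-> //|]; apply: c.
Qed.

Lemma continuous_locally_const M u :
    (forall x y : shift_space N, (forall i, (i <= M)%N -> x i = y i) -> u x = u y) ->
  continuous u.
Proof.
move=> uM x.
have nx : nbhs x (cylinder x M.+1).
  by apply: open_nbhs_nbhs; split; [exact: open_cylinder|].
move=> A /nbhs_singleton Aux; apply: filterS nx => y xy /=.
by rewrite (uM y x) // => i iM; rewrite xy.
Qed.

Lemma compact_shift : compact [set: shift_space N].
Proof.
have fin : finite_set [set: discrete_topology (symbol N)].
  exact: (@finite_finset 'I_N.-1.+1 setT).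
have := @tychonoff nat (fun=> discrete_topology (symbol N)) (fun=> setT)
  (fun=> finite_compact fin).
by congr compact; rewrite eqEsubset; split.
Qed.

Lemma continuous_bounded g : continuous g ->
  exists2 B, 0 <= B & forall x, `|g x| <= B.
Proof.
move=> cg.
have /compact_bounded[B [_ gB]] : compact (g @` [set: shift_space N]).
  apply: continuous_compact; last exact: compact_shift.
  exact: continuous_subspaceT.
exists (`|B| + 1) => [|x]; first by rewrite addr_ge0.
by apply: gB; [rewrite ltr_pwDr // ler_norm|exists x].
Qed.

Lemma continuous_measurable_shift g : continuous g ->
  measurable_fun setT (g : borel_shift N -> R).
Proof.
move=> /continuousP cg; apply: (measurability _ (RGenOpens.measurableE R)).
move=> _ [_ [a [b ->] <-]]; rewrite setTI; apply: sub_sigma_algebra.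
exact/cg/interval_open.
Qed.

Lemma measurable_cylinder p m :
  measurable (cylinder p m : set (borel_shift N)).
Proof. by apply: sub_sigma_algebra; exact: open_cylinder. Qed.

Lemma continuous_integrable (mu : probability (borel_shift N) R) g :
  continuous g -> mu.-integrable setT (EFin \o g).
Proof.
move=> cg; have [B B0 gB] := continuous_bounded cg.
apply: measurable_bounded_integrable => //.
- by have := @probability_setT _ _ _ mu; rewrite /= => ->; rewrite ltry.
- exact: continuous_measurable_shift.
- exists B; split=> [|b Bb x _]; first exact: ger0_real.
  exact: le_trans (gB x) (ltW Bb).
Qed.

(** The cylinders of length [m+1] around the points of [V m] partition the
    space, and [g (trunc m x)] is constant on each of them. *)
Lemma cylinder_sum m g x :
  g (trunc m x) = \sum_(p <- verts m) g p * \1_(cylinder p m.+1) x.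
Proof.
have tm : trunc m x \in verts m by rewrite mem_verts; apply/mem_set/V_trunc.
rewrite (bigD1_seq (trunc m x)) //=; last exact: fset_uniq.
rewrite indicE mem_set ?mulr1; last by apply/cylinder_trunc => //; exact: V_trunc.
rewrite big_seq_cond big1 ?addr0 // => p /andP[+ pt].
rewrite mem_verts => /set_mem Vp; rewrite indicE memNset ?mulr0 //.
by move/(cylinder_trunc Vp) => E; rewrite E eqxx in pt.
Qed.

Lemma integral_trunc (mu : probability (borel_shift N) R) m g :
  (forall p, mu (cylinder p m.+1) = (N%:R ^- m.+1)%:E) ->
  (\int[mu]_x (g (trunc m x))%:E =
    (\sum_(p <- verts m) N%:R ^- m.+1 * g p)%:E)%E.
Proof.
move=> hmu.
under eq_integral do rewrite cylinder_sum -sumEFin.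
rewrite integral_sum //; last first.
  move=> p; under eq_fun do rewrite EFinM.
  by apply: integrableZl => //; apply: integrable_indic; exact: measurable_cylinder.
rewrite -sumEFin; apply: eq_bigr => p _.
under eq_integral do rewrite EFinM.
rewrite integralZl //; last by apply: integrable_indic; exact: measurable_cylinder.
rewrite integral_indic //; last exact: measurable_cylinder.
by rewrite setIT; have := hmu p; rewrite /= => ->; rewrite -EFinM mulrC.
Qed.

(** The Riemann sum of level [m] is the integral of [g (trunc m x)], and
    [trunc m x] tends to [x]; [g] is bounded by compactness, so dominated
    convergence applies. *)
Lemma riemann_sum_cvg (mu : probability (borel_shift N) R) g :
  (forall p m, mu (cylinder p m) = (N%:R ^- m)%:E) -> continuous g ->
  \sum_(p <- verts m) N%:R ^- m.+1 * g p @[m --> \oo] -->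
    fine (\int[mu]_x (g x)%:E)%E.
Proof.
move=> hmu cg.
apply: (@fine_cvg _ _ _ _ (fun m =>
  (\sum_(p <- verts m) N%:R ^- m.+1 * g p)%:E)).
rewrite fineK; last first.
  exact: (integrable_fin_num measurableT (continuous_integrable mu cg)).
under eq_fun do rewrite -(integral_trunc (mu := mu)) //.
have [B B0 gB] := continuous_bounded cg.
apply: (@dominated_cvg _ _ _ mu setT measurableT _ _ (fun=> B%:E)) => //.
- move=> m; apply/measurable_EFinP.
  apply: (@continuous_measurable_shift (g \o trunc m)).
  apply: (@continuous_locally_const m) => x y xy /=; congr g.
  by apply/funext => i; apply: xy; exact: geq_minr.
- move=> x _; apply: cvg_EFin; first exact: nearW.
  apply: (cvg_comp (trunc ^~ x) g); last exact: cg.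
  by apply: cvg_agree => m i im; rewrite /trunc (minn_idPl (ltnW im)).
- exact: finite_measure_integrable_cst.
- by move=> m x _; rewrite abse_EFin lee_fin.
Qed.

End topology.

(** * The Gauss-Green formula *)

Section laplacian.
Context {R : realType} {N : nat}.
Variable mu : probability (borel_shift N) R.
Hypothesis hN : (2 <= N)%N.
Hypothesis hmu : forall (p : shift_space N) m,
  mu (cylinder p m) = (N%:R ^- m)%:E.
Implicit Types (p q x : shift_space N) (u v f g : shift_space N -> R).

(** The finite-support maximum only ranges over points where the defect is
    nonzero; at the others the bound is nonnegativity. *)
Lemma defect_le u f m A p : finite_set A -> A p ->
  `|H m u p / fine (mu (cylinder p m.+1)) - f p| <= max_defect mu u f m A.
Proof.
move=> fA Ap; rewrite /max_defect.
set F := fun p => `|H m u p / fine (mu (cylinder p m.+1)) - f p|.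
rewrite -/(F p); have [F0|F0] := eqVneq (F p) 0.
  rewrite F0; elim/big_rec: _ => // i y _ y0.
  by rewrite le_max normr_ge0.
apply: (le_bigmax_seq 0 p xpredT) => //.
rewrite in_finite_support; first by apply/mem_set; split => //; exact/eqP.
exact: finite_setIl.
Qed.

Lemma weight_gt0 m : 0 < N%:R ^- m :> R.
Proof. by rewrite invr_gt0 exprn_gt0 // ltr0n (leq_trans _ hN). Qed.

Lemma weight_cvg0 : N%:R ^- m.+1 @[m --> \oo] --> (0 : R).
Proof.
have : (N%:R^-1 ^+ m) @[m --> \oo] --> (0 : R).
  apply: cvg_expr; rewrite gtr0_norm ?invr_gt0 ?ltr0n ?(leq_trans _ hN) //.
  by rewrite invf_lt1 ?ltr1n // ltr0n (leq_trans _ hN).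
rewrite -cvg_shiftS /=.
by under eq_fun do rewrite exprVn.
Qed.

Lemma max_defect_ge0 u f m A : 0 <= max_defect mu u f m A.
Proof.
rewrite /max_defect; elim/big_rec: _ => // i y _ y0.
by rewrite le_max normr_ge0.
Qed.

(** The defect bound cleared of denominators, [1 / N ^ (m+1)] being the
    measure of a cylinder of length [m+1]. *)
Lemma H_approx u f m A p : finite_set A -> A p ->
  `|H m u p - N%:R ^- m.+1 * f p| <= N%:R ^- m.+1 * max_defect mu u f m A.
Proof.
move=> fA Ap; have w0 := weight_gt0 m.+1.
have := defect_le u f m fA Ap; rewrite hmu [fine _]/=.
rewrite -(ler_pM2l w0) -{1}[N%:R ^- m.+1]gtr0_norm // -normrM.
by rewrite mulrBr mulrCA divff ?mulr1 // gt_eqF.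
Qed.

Lemma sum_weight m : \sum_(p <- @verts N m) N%:R ^- m.+1 = 1 :> R.
Proof.
have := @integral_trunc R N mu m (fun=> 1) (hmu^~ m.+1).
under eq_bigr do rewrite mulr1.
rewrite integral_cst // mul1e.
by have := @probability_setT _ _ _ mu; rewrite /= => -> [].
Qed.

(** Replacing [H m u p] by [f p / N ^ (m+1)] costs at most a bound of [v] times
    the defect, because the weights sum to [1]; completing the sum to all of
    [V m] adds a fixed number of terms with weights tending to [0]. *)
Lemma sum_off_boundary_cvg M u v f : continuous v -> continuous f ->
    max_defect mu u f m (V m `\` V M) @[m --> \oo] --> 0 ->
  \sum_(p <- verts m | p \notin V M) v p * H m u p @[m --> \oo] -->
    fine (\int[mu]_x (f x * v x)%:E)%E.
Proof.
move=> cv cf du.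
have [B B0 vB] := continuous_bounded cv.
pose S m := \sum_(p <- verts m | p \notin V M) v p * H m u p.
pose Q m := \sum_(p <- verts m) N%:R ^- m.+1 * (f p * v p).
pose T m := N%:R ^- m.+1 * \sum_(p <- verts M) f p * v p.
have Qcvg : Q @ \oo --> fine (\int[mu]_x (f x * v x)%:E)%E.
  have cfv : continuous (fun x => f x * v x).
    by move=> x; exact: (continuousM (cf x) (cv x)).
  exact: (riemann_sum_cvg hmu cfv).
have Tcvg : T @ \oo --> 0.
  rewrite -[X in _ --> X](mul0r (\sum_(p <- verts M) f p * v p)).
  exact: cvgMr_tmp weight_cvg0.
(* For [m >= M], [T m] is the part over [V M] of the Riemann sum [Q m]. *)
have bound m : (M <= m)%N ->
    `|S m - Q m + T m| <= B * max_defect mu u f m (V m `\` V M).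
  move=> Mm; set d := max_defect _ _ _ _ _.
  have : T m = \sum_(p <- verts m | p \in V M) N%:R ^- m.+1 * (f p * v p).
    by rewrite /T mulr_sumr -sum_V (sum_verts_sub _ Mm).
  move=> TE; have QE : Q m =
      T m + \sum_(p <- verts m | p \notin V M) N%:R ^- m.+1 * (f p * v p).
    by rewrite TE /Q (bigID (mem (V M))).
  have -> : S m - Q m + T m =
      \sum_(p <- verts m | p \notin V M) v p * (H m u p - N%:R ^- m.+1 * f p).
    rewrite QE [T m + _]addrC opprD addrA addrNK /S -sumrB.
    by apply: eq_bigr => p _; rewrite mulrBr [f p * _]mulrC [w in _ - w]mulrCA.
  apply: le_trans (ler_norm_sum _ _ _) _.
  have -> : B * d = \sum_(p <- @verts N m) N%:R ^- m.+1 * (B * d).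
    by rewrite -mulr_suml sum_weight mul1r.
  rewrite [leRHS](bigID (mem (V M))) /= ler_wpDl //.
    apply: sumr_ge0 => p _; rewrite mulr_ge0 ?mulr_ge0 ?(ltW (weight_gt0 _)) //.
    exact: max_defect_ge0.
  rewrite big_seq_cond [leRHS]big_seq_cond; apply: ler_sum => p /andP[+ pM].
  rewrite mem_verts => /set_mem Vp.
  rewrite normrM [leRHS]mulrCA; apply: ler_pM; rewrite ?normr_ge0 ?vB //.
  apply: H_approx; first exact: sub_finite_set (@subDsetl _ _ _) (finite_V m).
  by split => // /mem_set pM'; rewrite pM' in pM.
suff : S @ \oo --> fine (\int[mu]_x (f x * v x)%:E)%E by [].
have -> : S = (fun m => (S m - Q m + T m) + Q m - T m).
  by apply/funext => m; rewrite addrAC addrK addrNK.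
rewrite -[X in _ --> X]add0r -[X in _ --> X]subr0.
apply: cvgB => //; apply: cvgD => //.
apply: norm_cvg0.
refine (@squeeze_cvgr _ _ _ _ (fun=> 0)
  (fun m => B * max_defect mu u f m (V m `\` V M)) _ _ 0 _ _).
- by exists M => // m /= Mm; rewrite normr_ge0 bound.
- exact: cvg_cst.
- by rewrite -[X in _ --> X](mulr0 B); exact: cvgMl_tmp.
Qed.

(** Existence of the Neumann derivative at a boundary point. *)
Lemma neumann_cvg M u f p : continuous f ->
    max_defect mu u f m (V m `\` V M) @[m --> \oo] --> 0 -> V M p ->
  - H m u p @[m --> \oo] --> neumann u p.
Proof.
move=> cf du Vp.
pose w : shift_space N -> R := \1_(cylinder p M.+1).
have wM (x y : shift_space N) :
    (forall i, (i <= M)%N -> x i = y i) -> w x = w y.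
  move=> xy; rewrite /w !indicE; congr (_ _)%:R.
  by apply/idP/idP => /set_mem c; apply/mem_set => i iM; rewrite -c // xy.
have cw := continuous_locally_const wM.
have := @sum_off_boundary_cvg M u w f cw cf du.
set S := fun m => _ => Scvg.
(* [neumann u p] is by definition the limit of this sequence. *)
suff : cvgn (fun m => - H m u p) by [].
apply/cvg_ex; exists (energyH M u w + fine (\int[mu]_x (f x * w x)%:E)%E).
apply: (@cvg_trans _ ((fun m => energyH M u w + S m) @ \oo)); last first.
  by apply: cvgD => //; exact: cvg_cst.
apply: near_eq_cvg; exists M => // m /= Mm.
have -> : energyH M u w = energyH m u w.
  rewrite /energyH; congr (- _).
  rewrite [RHS]sum_V (sum_verts_sub _ Mm) // big_mkcond /=.
  apply: eq_big_seq => q; rewrite mem_verts => /set_mem Vq.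
  by rewrite (H_locally_const wM Mm Vq); case: ifP => //; rewrite mulr0.
rewrite energyH_adj (bigID (mem (V M))) /= opprD addrNK; congr (- _).
(* [p] is the only point of [V M] where [w] does not vanish. *)
rewrite -(sum_verts_sub _ Mm) // sum_V (bigD1_seq p) ?fset_uniq //=; last first.
  by rewrite mem_verts; exact/mem_set.
rewrite /w indicE mem_set // mul1r big_seq_cond big1 ?addr0 // => q.
rewrite mem_verts => /andP[/set_mem Vq qp]; rewrite indicE memNset ?mul0r //.
by rewrite (cylinder_trunc Vp) trunc_id // => E; rewrite E eqxx in qp.
Qed.

(** The Gauss-Green formula, with the energy form of [u] and [v] as a limit of
    real numbers. *)
Theorem energy_cvg M u v f : continuous v -> continuous f ->
    max_defect mu u f m (V m `\` V M) @[m --> \oo] --> 0 ->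
  energyH m u v @[m --> \oo] -->
    \sum_(p \in V M) v p * neumann u p - fine (\int[mu]_x (f x * v x)%:E)%E.
Proof.
move=> cv cf du.
have := sum_off_boundary_cvg cv cf du; set S := fun m => _ => Scvg.
apply: (@cvg_trans _
    ((fun m => \sum_(p <- verts M | p \in V M) v p * - H m u p - S m) @ \oo)).
  apply: near_eq_cvg; exists M => // m /= Mm.
  rewrite energyH_adj [\sum_(p <- verts m) _](bigID (mem (V M))) /= opprD; congr (_ - _).
  rewrite -(sum_verts_sub _ (leqnn M)) // (sum_verts_sub _ Mm) //.
  by rewrite -sumrN; apply: eq_bigr => p _; rewrite mulrN.
apply: cvgB => //.
rewrite (sum_verts_sub _ (leqnn M)) //.
apply: cvg_big => [|p /set_mem Vp]; first exact: add_continuous.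
by apply: cvgMl_tmp; exact: neumann_cvg cf du Vp.
Qed.

Lemma laplacian_unique u f g :
  is_laplacian mu u f -> is_laplacian mu u g -> f = g.
Proof.
move=> [_ cf df] [_ cg dg]; apply/funext => x.
pose alt (a : symbol N) : symbol N := if a == ord0 then ord_max else ord0.
have altN a : alt a <> a.
  rewrite /alt; case: eqVneq => [-> /(congr1 val)/= E|a0 E]; last by rewrite -E eqxx in a0.
  by move: hN; rewrite -[N]prednK ?E // (leq_trans _ hN).
(* For [m > 0], [y m] copies [x] up to index [m - 1] and then repeats a letter different
   from [x (m - 1)], so that it lies in [V m] but not in [V (m - 1)]. *)
pose y m : shift_space N := fun i => if (i < m)%N then x i else alt (x m.-1).
have yx : y @ \oo --> x by apply: cvg_agree => m i im; rewrite /y im.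
have fy : f (y m) @[m --> \oo] --> f x by exact: (cvg_comp y f yx (cf x)).
have gy : g (y m) @[m --> \oo] --> g x by exact: (cvg_comp y g yx (cg x)).
have fg0 : f (y m) - g (y m) @[m --> \oo] --> 0.
  apply: norm_cvg0.
  refine (@squeeze_cvgr _ _ _ _ (fun=> 0)
    (fun m => max_defect mu u f m (V m `\` Vprev m) +
              max_defect mu u g m (V m `\` Vprev m)) _ _ 0 _ _).
  - exists 1%N => // m /= m1; rewrite normr_ge0 /=.
    have fin : finite_set (V m `\` @Vprev N m).
      exact: sub_finite_set (@subDsetl _ _ _) (finite_V m).
    have yV : (V m `\` Vprev m) (y m).
      split; first by move=> i mi; rewrite /y ltnn ltnNge mi.
      case: m m1 {fin} => // m _ /(_ m.+1 (leqnSn m)).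
      by rewrite /y ltnn ltnSn /=; exact: altN.
    rewrite -(subrKA (H m u (y m) / fine (mu (cylinder (y m) m.+1)))).
    apply: le_trans (ler_normD _ _) _; rewrite distrC.
    by apply: lerD; exact: defect_le.
  - exact: cvg_cst.
  - by rewrite -[X in _ --> X](addr0 0); exact: cvgD.
have fgE : f x - g x = 0 by exact: (cvg_unique _ (cvgB fy gy) fg0).
by apply/eqP; rewrite -subr_eq0 fgE.
Qed.

End laplacian.

Theorem theorem5p3 (R : realType) (N : nat) (hN : (2 <= N)%N)
    (mu : probability (borel_shift N) R)
    (hmu : forall (p : shift_space N) (m : nat),
       mu (cylinder p m) = (N%:R ^- m)%:E)
    (M : nat) (u v Delta_u : shift_space N -> R)
    (hu : domD mu M u) (hDelta : is_laplacian mu u Delta_u)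
    (hv : dom_energy v) :
  energy u v =
    ((\sum_(p \in V M) v p * neumann u p)%:E
       - \int[mu]_x (Delta_u x * v x)%:E)%E
  /\ (\sum_(p \in V M) neumann u p)%:E = (\int[mu]_x (Delta_u x)%:E)%E.
Proof.
have [f lf du] := hu.
have fD := laplacian_unique hN lf hDelta; subst f.
have [_ cD _] := hDelta; have [cv _] := hv.
have fin g : continuous g -> (fine (\int[mu]_x (Delta_u x * g x)%:E))%:E =
    (\int[mu]_x (Delta_u x * g x)%:E)%E.
  move=> cg; have cDg : continuous (fun x => Delta_u x * g x).
    by move=> x; exact: (continuousM (cD x) (cg x)).
  by rewrite fineK // (integrable_fin_num measurableT (continuous_integrable mu cDg)).
split.
  rewrite -fin // -EFinB; apply/cvg_lim => //.
  by apply: cvg_EFin; [exact: nearW|exact: (energy_cvg hN hmu cv cD du)].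
have c1 : continuous ((fun=> 1) : shift_space N -> R).
  exact: (@continuous_locally_const _ _ 0%N).
(* The constant function [1] has no differences along edges. *)
have E1 : energyH m u (fun=> 1) @[m --> \oo] --> 0.
  rewrite (_ : (fun m => _) = fun=> 0); first exact: cvg_cst.
  apply/funext => m; rewrite energyH_edge big1 ?oppr0 // => j _.
  by rewrite big1 // => p _; rewrite big1 // => q _; rewrite subrr.
have E : \sum_(p \in V M) 1 * neumann u p -
    fine (\int[mu]_x (Delta_u x * 1)%:E)%E = 0.
  exact: (cvg_unique _ (energy_cvg hN hmu c1 cD du) E1).
have := congr1 EFin (subr0_eq E).
rewrite (fin (fun=> 1)) //.
under eq_fsbigr do rewrite mul1r.
by move=> ->; apply: eq_integral => x _; rewrite mulr1.
Qed.
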